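(* Let $(A,B,\boldsymbol{c})$ be a positive $d$-dimensional instance of the Continuous Polytope Escape Problem with $A\in\mathbb{Q}^{d\times d}$, $B\in\mathbb{Q}^{n\times d}$, $\boldsymbol{c}\in\mathbb{Q}^n$, described by a tuple of bit size $b$, whose polytope $\mathcal{P}_{B,\boldsymbol{c}}$ is compact. If the matrix $A$ is diagonalisable or invertible, then the time to escape the polytope is bounded, uniformly over all initial points, by $T=O(4^{bd^2})$, which is singly exponential in the bit size and the dimension; that is, for every $\boldsymbol{x}_0\in\mathcal{P}_{B,\boldsymbol{c}}$ there exists $t_0\in[0,T]$ such that $\exp(At_0)\boldsymbol{x}_0\notin\mathcal{P}_{B,\boldsymbol{c}}$.
   Context: A $d$-dimensional instance of the Continuous Polytope Escape Problem (CPEP) is a triple $(A,B,\boldsymbol{c})$ representing the differential equation $\dot{\boldsymbol{x}}(t)=A\boldsymbol{x}(t)$, with solution $\boldsymbol{x}(t)=\exp(At)\boldsymbol{x}_0$, and the polytope $\mathcal{P}_{B,\boldsymbol{c}}=\{\boldsymbol{x}\in\mathbb{R}^d\mid B\boldsymbol{x}\le\boldsymbol{c}\}$ (componentwise inequality). The instance is positive if every trajectory escapes, i.e. for every $\boldsymbol{x}_0\in\mathcal{P}_{B,\boldsymbol{c}}$ there is $t\ge 0$ with $\exp(At)\boldsymbol{x}_0\notin\mathcal{P}_{B,\boldsymbol{c}}$ (re-entering later is allowed). Rational coefficients are encoded in binary. *)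

(* Defs.v *)
From HB Require Import structures.
From mathcomp Require Import all_boot all_order all_algebra.
From mathcomp Require Import all_classical all_reals all_analysis.
From mathcomp Require Import complex.

Set Implicit Arguments.
Unset Strict Implicit.
Unset Printing Implicit Defensive.

Import Order.TTheory GRing.Theory Num.Theory.
Import numFieldNormedType.Exports.

Local Open Scope classical_set_scope.
Local Open Scope ring_scope.

(* The limit is taken in the complete normed module 'M[R]_d, where this series
   always converges. *)
Definition expmx (R : realType) (d : nat) (M : 'M[R]_d) : 'M[R]_d :=
  limn (series (fun k : nat => k`!%:R^-1 *: M ^+ k)).

Definition polytope (R : realType) (n d : nat)
    (B : 'M[rat]_(n, d)) (c : 'cV[rat]_n) : set 'cV[R]_d :=
  [set x | forall i, (map_mx ratr B *m x) i 0 <= ratr (c i 0)].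

Arguments polytope R {n d} B c.

Definition trajectory (R : realType) (d : nat)
    (A : 'M[rat]_d) (x0 : 'cV[R]_d) (t : R) : 'cV[R]_d :=
  expmx (t *: map_mx ratr A) *m x0.

Definition cpep_positive (R : realType) (n d : nat)
    (A : 'M[rat]_d) (B : 'M[rat]_(n, d)) (c : 'cV[rat]_n) : Prop :=
  forall x0 : 'cV[R]_d, polytope R B c x0 ->
    exists2 t : R, 0 <= t & ~ polytope R B c (trajectory A x0 t).

Arguments cpep_positive R {n d} A B c.

(* A sign bit together with the binary digits of the numerator and of the
   denominator in lowest terms: up_log 2 m.+1 is the number of binary digits of
   m > 0. *)
Definition rat_bits (q : rat) : nat :=
  (1 + up_log 2 `|numq q|.+1 + up_log 2 `|denq q|.+1)%N.

Definition mx_bits (m n : nat) (M : 'M[rat]_(m, n)) : nat :=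
  (\sum_(i < m) \sum_(j < n) rat_bits (M i j))%N.

Definition cpep_bits (n d : nat)
    (A : 'M[rat]_d) (B : 'M[rat]_(n, d)) (c : 'cV[rat]_n) : nat :=
  (mx_bits A + mx_bits B + mx_bits c)%N.

Definition diagonalizable_over_C (R : realType) (d : nat) (A : 'M[rat]_d) :
    Prop :=
  diagonalizable (map_mx ratr A : 'M[R[i]]_d).

Arguments diagonalizable_over_C R {d} A.

(* Main.v *)
Require Import Defs.
From mathcomp Require Import all_boot all_order all_fingroup all_algebra.
From mathcomp Require Import all_classical all_reals all_analysis.
From mathcomp Require Import zify ring lra.
Import Order.TTheory GRing.Theory Num.Theory.
Import numFieldNormedType.Exports.
Local Open Scope ring_scope.

(* An equilibrium in the polytope P never escapes, so [A x <> 0] on P. Hence the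
   compact convex set A P misses the origin, and its point y closest to the
   origin satisfies [y . A x >= |y|^2] for all x in P: along a trajectory
   that stays in P, [y . x(t)] grows at speed at least |y|^2, although it is
   bounded on P.
   The escape time is therefore at most of the order of d times the largest
   coordinate on P divided by the minimum of the sup norm of A x over P. Both
   quantities are optimal values of linear programs, hence coordinates of
   vertices, and Cramer's rule turns them into quotients of determinants that
   the bit size controls. *)

(** * Vertices of polyhedra *)

(** The columns of [cokermx M] lie in the kernel of [M], and they all vanish only if [M] has full
    column rank. *)
Lemma not_row_full_kernel (F : fieldType) (m k : nat) (M : 'M[F]_(m, k)) :
  ~~ row_full M -> exists2 v : 'cV[F]_k, v != 0 & M *m v = 0.
Proof.
rewrite -cokermx_eq0 => K0.
have [j Kj|Kall] := pickP (fun j => col j (cokermx M) != 0).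
  by exists (col j (cokermx M)) => //; rewrite colE mulmxA mulmx_coker mul0mx.
case/eqP: K0; apply/matrixP => i j.
by have /eqP/matrixP/(_ i 0) := negbFE (Kall j); rewrite !mxE.
Qed.

(** The ratio test of the simplex method: [t] is the least ratio of slack to speed over the rows
    that [v] pushes upward. The row attaining it becomes tight, and tight rows stay tight because
    [v] does not move them. *)
Lemma active_rows_step (F : realFieldType) (m k : nat) (M : 'M[F]_(m, k))
    (g : 'cV[F]_m) (x v : 'cV[F]_k) (i0 : 'I_m) :
  (forall i, (M *m x) i 0 <= g i 0) ->
  (forall i, (M *m x) i 0 = g i 0 -> (M *m v) i 0 = 0) ->
  0 < (M *m v) i0 0 ->
  exists t : F, [/\ 0 <= t, (forall i, (M *m (x + t *: v)) i 0 <= g i 0) &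
    [set i | (M *m x) i 0 == g i 0] \proper
    [set i | (M *m (x + t *: v)) i 0 == g i 0]].
Proof.
move=> feas act v0.
have E t i : (M *m (x + t *: v)) i 0 = (M *m x) i 0 + t * (M *m v) i 0.
  by rewrite mulmxDr -scalemxAr !mxE.
pose r i := (g i 0 - (M *m x) i 0) / (M *m v) i 0.
have [i1 v1 min1] := @Order.TotalTheory.arg_minP _ F 'I_m i0
  (fun i => 0 < (M *m v) i 0) r v0.
exists (r i1); split.
- by rewrite divr_ge0 ?subr_ge0 // ltW.
- move=> i; rewrite E; have [vi|vi] := ltP 0 ((M *m v) i 0).
    by rewrite -lerBrDl -ler_pdivlMr // min1.
  rewrite -[leRHS]addr0 lerD // mulr_ge0_le0 //.
  by rewrite divr_ge0 ?subr_ge0 // ltW.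
- apply/properP; split.
    apply/fintype.subsetP => i; rewrite !inE E => /eqP ai.
    by rewrite act // mulr0 addr0 ai.
  exists i1; rewrite !inE.
    by rewrite E /r divfK ?lt0r_neq0 // addrC subrK.
  by apply/eqP => /act a1; rewrite a1 ltxx in v1.
Qed.

(** Induction on the number of slack constraints. While the tight rows lack full column rank, some
    direction fixes them all, and the optimum slides along it until another constraint becomes
    tight; [kerM] excludes lines in the polyhedron, so the slide ends. At full rank, [k] independent
    tight rows determine the point. *)
Lemma lp_vertex (F : realFieldType) (m k : nat) (M : 'M[F]_(m, k))
    (g : 'cV[F]_m) (u : 'rV[F]_k) (x0 : 'cV[F]_k) :
  (forall v : 'cV[F]_k, M *m v = 0 -> v = 0) ->
  (forall i, (M *m x0) i 0 <= g i 0) ->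
  (forall x : 'cV[F]_k, (forall i, (M *m x) i 0 <= g i 0) ->
     (u *m x) 0 0 <= (u *m x0) 0 0) ->
  exists (x : 'cV[F]_k) (f : 'I_k -> 'I_m),
    [/\ injective f, rowsub f M \in unitmx, rowsub f M *m x = rowsub f g &
        (u *m x) 0 0 = (u *m x0) 0 0].
Proof.
move=> kerM feas0 opt0.
pose act (x : 'cV[F]_k) := [set i | (M *m x) i 0 == g i 0].
have [N] := ubnP (m - #|act x0|); elim: N => // N IH in x0 feas0 opt0 *.
rewrite ltnS => leN.
(* Slack rows are zeroed rather than removed, so [Mz] keeps the row indices of [M]; a zero row
   cannot be among the independent rows chosen by [fullrankfun]. *)
pose Mz := \matrix_(i < m, j < k) (if i \in act x0 then M i j else 0).
have Mz_row i (v : 'cV[F]_k) :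
    (Mz *m v) i 0 = if i \in act x0 then (M *m v) i 0 else 0.
  rewrite !mxE; case: ifP => ai; last first.
    by rewrite big1 // => j _; rewrite mxE ai mul0r.
  by apply: eq_bigr => j _; rewrite mxE ai.
have [full|/not_row_full_kernel[v v_neq0 Mzv]] := boolP (row_full Mz).
  have fact i : fullrankfun full i \in act x0.
    apply/negPn/negP => ai.
    have := mulmx_free_eq0 (delta_mx 0 i : 'rV[F]_k) (fullrowsub_free full).
    rewrite -rowE; suff -> : row i (rowsub (fullrankfun full) Mz) = 0.
      by rewrite eqxx => /esym/eqP/rowP/(_ i)/eqP; rewrite !mxE !eqxx oner_eq0.
    by apply/rowP => j; rewrite !mxE (negPf ai).
  have subE : rowsub (fullrankfun full) M = rowsub (fullrankfun full) Mz.
    by apply/matrixP => i j; rewrite !mxE fact.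
  exists x0, (fullrankfun full); split=> //; first exact: fullrankfun_inj.
    by rewrite subE fullrowsub_unit.
  apply/colP => i; have := fact i; rewrite inE => /eqP; rewrite !mxE => <-.
  by apply: eq_bigr => j _; rewrite !mxE.
have act0 i : i \in act x0 -> (M *m v) i 0 = 0.
  by move=> ai; have /matrixP/(_ i 0) := Mzv; rewrite Mz_row ai [RHS]mxE.
(* Moving along [w] does not lower the objective and optimality of [x0] forbids raising it: the new
   point is optimal with strictly more tight rows. *)
have step (w : 'cV[F]_k) i1 : (forall i, i \in act x0 -> (M *m w) i 0 = 0) ->
    0 <= (u *m w) 0 0 -> 0 < (M *m w) i1 0 ->
    exists (x : 'cV[F]_k) (f : 'I_k -> 'I_m),
    [/\ injective f, rowsub f M \in unitmx, rowsub f M *m x = rowsub f g &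
        (u *m x) 0 0 = (u *m x0) 0 0].
  move=> actw uw w1.
  have [|t [t0 feas1 lt01]] := @active_rows_step _ _ _ M g x0 w i1 feas0 _ w1.
    by move=> i ai; apply: actw; rewrite inE ai.
  have ux : (u *m (x0 + t *: w)) 0 0 = (u *m x0) 0 0.
    apply/le_anti; rewrite opt0 //=.
    have -> : (u *m (x0 + t *: w)) 0 0 = (u *m x0) 0 0 + t * (u *m w) 0 0.
      by rewrite mulmxDr -scalemxAr !mxE.
    by rewrite lerDl mulr_ge0.
  have opt1 (x : 'cV[F]_k) : (forall i, (M *m x) i 0 <= g i 0) ->
      (u *m x) 0 0 <= (u *m (x0 + t *: w)) 0 0 by rewrite ux; apply: opt0.
  rewrite -ux; apply: IH opt1 _ => //; apply: leq_trans leN.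
  apply: ltn_sub2l (proper_card lt01); apply: leq_trans (proper_card lt01) _.
  by rewrite -[leqRHS]card_ord max_card.
wlog uv : v v_neq0 Mzv act0 / 0 <= (u *m v) 0 0.
  move=> wl; have [|/ltW uv] := leP 0 ((u *m v) 0 0); first exact: wl.
  apply: (wl (- v)); first by rewrite oppr_eq0.
  - by rewrite mulmxN Mzv oppr0.
  - by move=> i ai; rewrite mulmxN [LHS]mxE act0 ?oppr0.
  - by rewrite mulmxN [leRHS]mxE oppr_ge0.
have [i1 v1|Mv_le0] := pickP (fun i => 0 < (M *m v) i 0).
  exact: step act0 uv v1.
(* No constraint blocks [v], so [x0 + v] is feasible and optimality forces [u *m v = 0]. The
   direction [- v] is then equally good, and it is blocked because [M *m v] is nonzero. *)
have feasv : forall i, (M *m (x0 + v)) i 0 <= g i 0.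
  move=> i; rewrite mulmxDr [leLHS]mxE -[leRHS]addr0 lerD //.
  by rewrite leNgt Mv_le0.
have {}uv : (u *m v) 0 0 = 0.
  apply/le_anti; rewrite uv andbT -(lerD2l ((u *m x0) 0 0)) addr0.
  by have := opt0 _ feasv; rewrite mulmxDr [leLHS]mxE.
have [i1 v1|Mv0] := pickP (fun i => (M *m v) i 0 != 0); last first.
  case/eqP: v_neq0; apply: kerM; apply/colP => i.
  by rewrite [RHS]mxE; apply/eqP; rewrite -[_ == _]negbK Mv0.
apply: (step (- v) i1).
- by move=> i /act0 vi; rewrite mulmxN [LHS]mxE vi oppr0.
- by rewrite mulmxN [leRHS]mxE uv oppr0.
- by rewrite mulmxN [ltRHS]mxE oppr_gt0 lt_neqAle v1 leNgt Mv_le0.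
Qed.

(** * Rational determinants and bit size *)

(** By [rat_weightE] this is [(1 + |q|)] times the denominator: the first factor serves to bound
    determinants from above, the second to clear denominators. *)
Definition rat_weight (q : rat) : nat := (`|numq q| + `|denq q|)%N.

Lemma rat_weightE (q : rat) : (rat_weight q)%:R = (1 + `|q|) * (denq q)%:~R.
Proof.
have den_gt0 : 0 < (denq q)%:~R :> rat by rewrite ltr0z denq_gt0.
rewrite mulrDl mul1r -[X in `|q| * X]gtr0_norm // -normrM.
rewrite -[X in `|X * _|]divq_num_den divfK ?gt_eqF //.
by rewrite natrD addrC !natr_absz (gtr0_norm (denq_gt0 q)) intr_norm.
Qed.

(** The Leibniz terms are, in absolute value, among the terms of the expanded product of row sums,
    which runs over all functions instead of permutations. *)
Lemma det_norm_le (k : nat) (M : 'M[rat]_k) :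
  `|\det M| <= \prod_i \prod_j (1 + `|M i j|).
Proof.
apply: (@le_trans _ _ (\prod_i \sum_j `|M i j|)).
  rewrite bigA_distr_bigA /= /determinant; apply: le_trans (ler_norm_sum _ _ _) _.
  under [leLHS]eq_bigr do rewrite normrM normrX normrN1 expr1n mul1r normr_prod.
  under [leLHS]eq_bigr => s _ do under eq_bigr => i _ do rewrite -pvalE.
  rewrite -(big_imset (fun f : {ffun 'I_k -> 'I_k} => \prod_i `|M i (f i)|)) /=.
    rewrite [leRHS](bigID [in [set pval s | s : 'S_k]]) /= lerDl.
    by rewrite sumr_ge0 // => f _; rewrite prodr_ge0.
  by move=> s t _ _; exact: val_inj.
apply: ler_prod => i _; rewrite sumr_ge0 //=.
(* The induction adding one factor at a time also needs the product to be at least 1. *)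
suff [] : \sum_j `|M i j| <= \prod_j (1 + `|M i j|) :> rat /\
   1 <= \prod_j (1 + `|M i j|) :> rat by [].
elim/big_rec2: _ => [|j a b _ [ab b1]]; first by rewrite ler01.
split; rewrite mulrDl mul1r.
  by rewrite addrC lerD // ler_peMr.
by rewrite -[leLHS]addr0 lerD // mulr_ge0 // (le_trans _ b1).
Qed.

(** Each Leibniz term uses one entry per row, and the denominator of that entry is a factor of the
    product. *)
Lemma det_rat_denominator (k : nat) (M : 'M[rat]_k) :
  \det M * \prod_i \prod_j (denq (M i j))%:~R \is a Num.int.
Proof.
rewrite /determinant mulr_suml rpred_sum // => s _.
rewrite -mulrA rpredMsign -big_split rpred_prod //= => i _.
rewrite (bigD1 (s i)) //= mulrA -{1}[M i (s i)]divq_num_den divfK ?intr_eq0 ?denq_neq0 //.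
by rewrite rpredM ?rpred_int // rpred_prod // => j _; exact: rpred_int.
Qed.

Lemma det_rat_ge (k : nat) (M : 'M[rat]_k) : \det M != 0 ->
  1 <= `|\det M| * \prod_i \prod_j (denq (M i j))%:~R.
Proof.
move=> detM; have den_gt0 : 0 < \prod_i \prod_j (denq (M i j))%:~R :> rat.
  by do 2!apply: prodr_gt0 => ? _; rewrite ltr0z denq_gt0.
rewrite -[X in _ * X]gtr0_norm // -normrM norm_intr_ge1 ?det_rat_denominator //.
by rewrite mulf_neq0 // gt_eqF.
Qed.

(** Division-free Cramer's rule: multiply [M *m x] by the adjugate, and expand the right-hand
    determinant along column [j], whose cofactors are those of [M]. *)
Lemma cramer (F : comNzRingType) (k : nat) (M : 'M[F]_k) (x : 'cV[F]_k) j :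
  x j 0 * \det M =
  \det (\matrix_(i, l) if l == j then (M *m x) i 0 else M i l).
Proof.
set N := \matrix_(_, _) _.
have -> : x j 0 * \det M = (\adj M *m (M *m x)) j 0.
  by rewrite mulmxA mul_adj_mx mul_scalar_mx mxE mulrC.
rewrite (expand_det_col N j) [LHS]mxE; apply: eq_bigr => i _.
rewrite [in RHS]mxE eqxx mulrC; congr (_ * _).
rewrite mxE /cofactor; congr (_ * \det _); apply/matrixP => a b.
by rewrite !mxE eq_sym (negPf (neq_lift _ _)).
Qed.

Lemma rat_weight_gt0 (q : rat) : (0 < rat_weight q)%N.
Proof. by rewrite addn_gt0 orbC absz_gt0 denq_neq0. Qed.

(** Let [D] be the product of the denominators of [M]. Then [|\det M| * D >= 1], while
    [|\det N| * D <= W]: outside column [j] the factors [1 + |q|] from [N] and the denominators from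
    [M] belong to the same entries and merge into one weight each. Shared entries are thus counted
    only once. *)
Lemma det_ratio_le (k : nat) (M N : 'M[rat]_k) j :
  (forall i l, l != j -> N i l = M i l) -> \det M != 0 ->
  `|\det N| <=
    (\prod_i (rat_weight (N i j) * \prod_l rat_weight (M i l)))%:R * `|\det M|.
Proof.
move=> eqMN detM; set W := (X in X%:R).
pose D := \prod_i \prod_j (denq (M i j))%:~R : rat.
have D_gt0 : 0 < D by do 2!apply: prodr_gt0 => ? _; rewrite ltr0z denq_gt0.
have den_ge0 q : 0 <= (denq q)%:~R :> rat by rewrite ler0z ltW ?denq_gt0.
have leW : `|\det N| * D <= W%:R.
  apply: (@le_trans _ _ ((\prod_i \prod_l (1 + `|N i l|)) * D)).
    by rewrite ler_wpM2r ?det_norm_le ?ltW.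
  rewrite -big_split natr_prod /=; apply: ler_prod => i _.
  rewrite -big_split /=; apply/andP; split.
    by rewrite prodr_ge0 // => l _; rewrite mulr_ge0 ?addr_ge0 ?den_ge0.
  rewrite natrM natr_prod [leLHS](bigD1 j) //= [X in _ <= _ * X](bigD1 j) //= mulrA.
  under [X in _ * X <= _]eq_bigr => l lj do rewrite eqMN // -rat_weightE.
  rewrite ler_wpM2r ?prodr_ge0 // !rat_weightE.
  apply: ler_pM; rewrite ?addr_ge0 ?den_ge0 //.
    by rewrite ler_peMr ?addr_ge0 // ler1z -gtz0_ge1 denq_gt0.
  by rewrite ler_peMl ?den_ge0 // lerDl.
rewrite -(ler_pM2r D_gt0) -mulrA; apply: le_trans leW _.
by rewrite ler_peMr // det_rat_ge.
Qed.

(** The coordinate is a quotient of two determinants whose matrices differ in column [j]. Both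
    bounds come from [det_ratio_le], used in the two directions: [W] is unchanged when [g] and
    column [j] of [M] are exchanged. *)
Lemma cramer_bounds (F : realFieldType) (k : nat) (M : 'M[rat]_k)
    (g : 'cV[rat]_k) (x : 'cV[F]_k) j
    (W := (\prod_i (rat_weight (g i 0%R) * \prod_l rat_weight (M i l)))%N) :
  map_mx ratr M \in (unitmx : {pred 'M[F]_k}) ->
  map_mx ratr M *m x = map_mx ratr g ->
  `|x j 0| <= W%:R /\ (x j 0 != 0 -> 1 <= W%:R * `|x j 0|).
Proof.
rewrite map_unitmx unitmxE unitfE => detM Mx.
pose N := \matrix_(i, l) if l == j then g i 0 else M i l.
have xE : x j 0 * ratr (\det M) = ratr (\det N).
  rewrite -!det_map_mx cramer Mx; congr (\det _).
  by apply/matrixP => i l; rewrite !mxE; case: ifP; rewrite ?mxE.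
have NM i l : l != j -> N i l = M i l by rewrite mxE => /negPf ->.
have gN i : N i j = g i 0 by rewrite mxE eqxx.
have absM : 0 < ratr `|\det M| :> F by rewrite ltr0q normr_gt0.
have absx : `|x j 0| * ratr `|\det M| = ratr `|\det N|.
  by rewrite !ratr_norm -normrM xE.
split.
  rewrite -(ler_pM2r absM) absx -ratr_nat -rmorphM ler_rat /W.
  under eq_bigr do rewrite -gN.
  exact: det_ratio_le.
move=> x0; rewrite -(ler_pM2r absM) mul1r -mulrA absx -ratr_nat -rmorphM ler_rat.
have -> : W = (\prod_i (rat_weight (M i j) * \prod_l rat_weight (N i l)))%N.
  apply: eq_bigr => i _; rewrite (bigD1 j) //= [in RHS](bigD1 j) //= gN mulnCA.
  by congr (_ * (_ * _))%N; apply: eq_bigr => l /NM ->.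
apply: det_ratio_le => [i l /NM -> //|].
have : x j 0 * ratr (\det M) != 0 by rewrite mulf_neq0 // fmorph_eq0.
by rewrite xE fmorph_eq0.
Qed.

(** * Optimal values of rational linear programs and their bit size *)

Lemma prod_inj_le (m k : nat) (f : 'I_k -> 'I_m) (E : 'I_m -> nat) :
  injective f -> (forall i, 0 < E i)%N -> (\prod_i E (f i) <= \prod_i E i)%N.
Proof.
move=> f_inj E_gt0; rewrite -(big_imset E (A := predT)) /=; last first.
  by move=> ? ? _ _; apply: f_inj.
by rewrite [leqRHS](bigID [in [set f i | i in predT]]) /= leq_pmulr // prodn_gt0.
Qed.

(** The sign of [e] selects maximisation or minimisation of coordinate [j]. Some vertex has the same
    optimal value and solves a square subsystem, which weighs at most as much as the whole system
    since every weight is at least 1. *)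
Lemma lp_optimum_bounds (F : realFieldType) (m k : nat) (M : 'M[rat]_(m, k))
    (g : 'cV[rat]_m) (e : F) (j : 'I_k) (x0 : 'cV[F]_k)
    (W := (\prod_i (rat_weight (g i 0%R) * \prod_l rat_weight (M i l)))%N) :
  e != 0 ->
  (forall v : 'cV[F]_k, map_mx ratr M *m v = 0 -> v = 0) ->
  (forall i, (map_mx ratr M *m x0) i 0 <= ratr (g i 0)) ->
  (forall x : 'cV[F]_k, (forall i, (map_mx ratr M *m x) i 0 <= ratr (g i 0)) ->
     e * x j 0 <= e * x0 j 0) ->
  `|x0 j 0| <= W%:R /\ (x0 j 0 != 0 -> 1 <= W%:R * `|x0 j 0|).
Proof.
move=> e0 kerM feas0 opt0.
have uE x : (e *: delta_mx 0 j *m x : 'M[F]_1) 0 0 = e * x j 0.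
  by rewrite -scalemxAl -rowE !mxE.
have [||x|x [f [f_inj unitM Mx xj]]] := @lp_vertex F m k (map_mx ratr M)
    (map_mx ratr g) (e *: delta_mx 0 j) x0.
- exact: kerM.
- by move=> i; rewrite [leRHS]mxE.
- by move=> feas; rewrite !uE opt0 // => i; have := feas i; rewrite [leRHS]mxE.
have {}xj : x j 0 = x0 j 0 by apply: (mulfI e0); rewrite -!uE.
rewrite -!map_mxsub in unitM Mx.
have [leW geW] := cramer_bounds _ _ _ _ _ j unitM Mx; rewrite xj in leW geW.
have W_le : (\prod_i (rat_weight (rowsub f g i 0%R) *
    \prod_l rat_weight (rowsub f M i l)) <= W)%N.
  under eq_bigr => i _ do rewrite mxE.
  under eq_bigr => i _ do under eq_bigr do rewrite mxE.
  apply: (prod_inj_le _ _ f (fun i => _ * _)%N) => // i.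
  by rewrite muln_gt0 rat_weight_gt0 prodn_gt0 // => l; rewrite rat_weight_gt0.
split; first by apply: le_trans leW _; rewrite ler_nat.
move=> /geW le1; apply: le_trans le1 _.
by rewrite ler_wpM2r // ler_nat.
Qed.

(** The sign bit pays for the factor 2 in [p + r <= 2 * (a * b)], where [a] and [b] are powers of
    two above the numerator and the denominator. *)
Lemma rat_weight_le_bits (q : rat) : (rat_weight q <= 2 ^ rat_bits q)%N.
Proof.
rewrite /rat_weight /rat_bits -addnA expnD expn1 expnD.
have h k : (k < 2 ^ up_log 2 k.+1)%N by apply: up_logP.
have := h `|numq q|%N; have := h `|denq q|%N.
set a := (2 ^ _)%N; set b := (2 ^ _)%N; set p := `|_|%N; set r := `|_|%N => pa rb.
nia.
Qed.

Lemma mx_weight_le_bits (m n : nat) (M : 'M[rat]_(m, n)) :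
  (\prod_i \prod_j rat_weight (M i j) <= 2 ^ mx_bits M)%N.
Proof.
rewrite /mx_bits expn_sum; apply: leq_prod => i _.
by rewrite expn_sum; apply: leq_prod => j _; apply: rat_weight_le_bits.
Qed.

Lemma system_weight_le_bits (n d : nat) (B : 'M[rat]_(n, d)) (c : 'cV[rat]_n) :
  (\prod_i (rat_weight (c i 0%R) * \prod_l rat_weight (B i l)) <=
   2 ^ (mx_bits B + mx_bits c))%N.
Proof.
rewrite big_split /= mulnC expnD leq_mul ?mx_weight_le_bits //.
by apply: leq_trans (mx_weight_le_bits _ _ c); apply: leq_prod => i _; rewrite big_ord1.
Qed.

(* The constraints [B x <= c] and [-s <= (A x)_i <= s] in the unknowns [(x, s)]. *)
Definition sup_norm_lp_mx (n d : nat) (A : 'M[rat]_d) (B : 'M[rat]_(n, d)) :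
    'M[rat]_(n + (d + d), d + 1) :=
  col_mx (row_mx B 0)
    (col_mx (row_mx A (const_mx (-1))) (row_mx (- A) (const_mx (-1)))).

Definition sup_norm_lp_rhs (n d : nat) (c : 'cV[rat]_n) : 'cV[rat]_(n + (d + d)) :=
  col_mx c 0.

(** The matrix [A] occurs twice up to sign, each time with a column of [d] entries -1 of weight 2;
    zeros have weight 1 and cost nothing. *)
Lemma sup_norm_lp_weight_le_bits (n d : nat) (A : 'M[rat]_d)
    (B : 'M[rat]_(n, d)) (c : 'cV[rat]_n) :
  (\prod_i (rat_weight (sup_norm_lp_rhs n d c i 0%R) *
     \prod_l rat_weight (sup_norm_lp_mx n d A B i l)) <=
   2 ^ (mx_bits B + mx_bits c + 2 * (mx_bits A + d)))%N.
Proof.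
have w0 : rat_weight 0 = 1%N by [].
have w1 : rat_weight (-1) = 2%N by [].
have wN q : rat_weight (- q) = rat_weight q.
  by rewrite /rat_weight numqN denqN abszN.
have ABw s : (forall q, rat_weight (s q) = rat_weight q) ->
  (\prod_(i < d) (1 * \prod_(l < d + 1) rat_weight
    (row_mx (map_mx s A) (const_mx (-1)%R : 'cV[rat]_d) i l)) <= 2 ^ (mx_bits A + d))%N.
  move=> ws; under eq_bigr => i _.
    rewrite mul1n big_split_ord /= big_ord1 row_mxEr mxE w1.
    under eq_bigr => l _ do rewrite row_mxEl mxE ws.
    over.
  rewrite big_split /= prod_nat_const card_ord expnD leq_mul //.
  exact: mx_weight_le_bits.
rewrite big_split_ord /= big_split_ord /=.
apply: (@leq_trans (2 ^ (mx_bits B + mx_bits c) *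
    (2 ^ (mx_bits A + d) * 2 ^ (mx_bits A + d)))); last first.
  by rewrite -!expnD leq_exp2l // mul2n addnn.
rewrite /sup_norm_lp_rhs /sup_norm_lp_mx; apply: leq_mul; last apply: leq_mul.
- apply: leq_trans (system_weight_le_bits _ _ B c); apply: leq_prod => i _.
  rewrite col_mxEu leq_mul // big_split_ord /= big_ord1 col_mxEu row_mxEr mxE w0 muln1.
  by apply: leq_prod => l _; rewrite col_mxEu row_mxEl.
- apply: leq_trans (ABw id _) => //; apply: leq_prod => i _.
  rewrite col_mxEd mxE w0 leq_mul //.
  by apply: leq_prod => l _; rewrite col_mxEd col_mxEu map_mx_id.
- apply: leq_trans (ABw -%R wN); apply: leq_prod => i _.
  rewrite col_mxEd mxE w0 leq_mul //; apply: leq_prod => l _.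
  rewrite !col_mxEd.
  by have -> : map_mx -%R A = - A by apply/matrixP => a b; rewrite !mxE.
Qed.

(** * Trajectories *)

Local Open Scope classical_set_scope.
Local Open Scope ring_scope.

Lemma mx_expr_entry_le (R : realDomainType) (d : nat) (M : 'M[R]_d) k i j :
  `|(M ^+ k) i j| <= (\sum_i \sum_j `|M i j|) ^+ k.
Proof.
elim: k i j => [|k IH] i j.
  by rewrite !expr0 mxE; case: eqP; rewrite ?normr1 ?normr0.
rewrite !exprS mxE; apply: le_trans (ler_norm_sum _ _ _) _.
have row_le : \sum_l `|M i l| <= \sum_i \sum_j `|M i j|.
  by rewrite [leRHS](bigD1 i) //= lerDl sumr_ge0 // => ? _; rewrite sumr_ge0.
apply: le_trans (_ : _ <= (\sum_l `|M i l|) * _) _; last first.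
  apply: ler_wpM2r row_le.
  by rewrite exprn_ge0 // sumr_ge0 // => ? _; rewrite sumr_ge0.
by rewrite mulr_suml; apply: ler_sum => l _; rewrite normrM ler_wpM2l.
Qed.

Lemma cvg_mx_entries (R : realType) (m n : nat) (F : nat -> 'M[R]_(m, n))
    (L : 'M[R]_(m, n)) :
  (forall i j, (fun k => F k i j) @ \oo --> L i j) -> F @ \oo --> L.
Proof.
move=> FL A [P nP sPA]; change (\forall k \near \oo, A (F k)).
apply: (filterS (P := fun k => forall i j, P i j (F k i j))).
  by move=> k; apply: sPA.
apply: (@filter_forall nat 'I_m (fun i k => forall j, P i j (F k i j)) \oo) => i.
apply: (@filter_forall nat 'I_n (fun j k => P i j (F k i j)) \oo) => j.
exact: FL (nP i j).
Qed.

(** Each entry is dominated by the scalar exponential series at the sum of the absolute values of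
    all entries of [M]. *)
Lemma is_cvg_expmx (R : realType) (d : nat) (M : 'M[R]_d) :
  cvgn (series (fun k : nat => k`!%:R^-1 *: M ^+ k)).
Proof.
have cvg_entry i j : cvgn (series (fun k : nat => (M ^+ k) i j / k`!%:R)).
  apply: normed_cvg; set a := \sum_i \sum_j `|M i j|.
  have a_ge0 : 0 <= a by rewrite sumr_ge0 // => ? _; rewrite sumr_ge0.
  apply: (series_le_cvg (v_ := exp_coeff a)); last exact: is_cvg_series_exp_coeff.
  - by move=> k /=.
  - by move=> k; rewrite /exp_coeff /= divr_ge0 // exprn_ge0.
  - move=> k /=; rewrite normrM normfV [X in _ / X]ger0_norm // /exp_coeff /=.
    by rewrite ler_wpM2r ?invr_ge0 ?mx_expr_entry_le.
apply/cvg_ex; exists (\matrix_(i, j) limn (series (fun k => (M ^+ k) i j / k`!%:R))).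
apply: cvg_mx_entries => i j; rewrite mxE; apply: cvg_trans (cvg_entry i j).
apply: near_eq_cvg; apply: nearW => n; rewrite /series /= summxE.
by apply: eq_bigr => k _; rewrite mxE mulrC.
Qed.

Lemma bilinear_mx_continuous (R : realType) (m n : nat) (u : 'rV[R]_m) (x : 'cV[R]_n) :
  continuous (fun M : 'M[R]_(m, n) => (u *m M *m x) 0 0).
Proof.
have -> : (fun M : 'M[R]_(m, n) => (u *m M *m x) 0 0) =
   (fun M : 'M[R]_(m, n) => \sum_j \sum_i u 0 i * M i j * x j 0).
  by apply/funext => M; rewrite mxE; apply: eq_bigr => j _; rewrite mxE mulr_suml.
move=> M; have FM : Filter (nbhs M) by exact: nbhs_filter.
apply: (cvg_big add_continuous FM) => j _; apply: (cvg_big add_continuous FM) => i _.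
apply: cvgM; last exact: cvg_cst.
apply: cvgM; first exact: cvg_cst.
exact: coord_continuous.
Qed.

Lemma scale_mx_expr (R : comPzRingType) (d : nat) (t : R) (M : 'M[R]_d) k :
  (t *: M) ^+ k = t ^+ k *: M ^+ k.
Proof.
elim: k => [|k IH]; first by rewrite !expr0 scale1r.
rewrite !exprS IH -[LHS]/((t *: M) *m (t ^+ k *: M ^+ k)).
by rewrite -scalemxAl -scalemxAr scalerA.
Qed.

(** Taylor coefficients at 0 of a linear functional along the trajectory, which reduce
    differentiation of the matrix exponential to scalar power series. *)
Definition trajectory_coef (R : realType) (d : nat) (M : 'M[R]_d)
  (x : 'cV[R]_d) (u : 'rV[R]_d) (k : nat) : R := (u *m M ^+ k *m x) 0 0 / k`!%:R.

Lemma trajectory_pseries (R : realType) (d : nat) (M : 'M[R]_d)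
    (x : 'cV[R]_d) (u : 'rV[R]_d) (t : R) :
  pseries (trajectory_coef R d M x u) t @ \oo --> (u *m expmx (t *: M) *m x) 0 0.
Proof.
have := is_cvg_expmx _ _ (t *: M) => /cvg_ex[E].
move=> EE; have -> : expmx (t *: M) = E by exact: cvg_lim EE.
suff -> : pseries (trajectory_coef R d M x u) t =
    (fun N => (u *m N *m x) 0 0) \o series (fun k => k`!%:R^-1 *: (t *: M) ^+ k).
  exact: continuous_cvg _ (bilinear_mx_continuous _ _ _ u x E) EE.
apply/funext => n; rewrite /pseries /series /=.
rewrite mulmx_sumr mulmx_suml summxE; apply: eq_bigr => k _.
rewrite scale_mx_expr -!scalemxAr -!scalemxAl /trajectory_coef.
by rewrite [RHS]mxE [X in _ = _ * X]mxE mulrCA [LHS]mulrC; congr (_ * _); exact: mulrC.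
Qed.

Lemma pseries_diffs_trajectory_coef (R : realType) (d : nat) (M : 'M[R]_d)
    (x : 'cV[R]_d) (u : 'rV[R]_d) :
  pseries_diffs (trajectory_coef R d M x u) = trajectory_coef R d M x (u *m M).
Proof.
apply/funext => k; rewrite /pseries_diffs /trajectory_coef factS natrM invfM.
rewrite exprS mulmxA.
by rewrite mulrCA mulVKf ?pnatr_eq0.
Qed.

Lemma is_derive_trajectory (R : realType) (d : nat) (M : 'M[R]_d)
    (x : 'cV[R]_d) (u : 'rV[R]_d) (t : R) :
  is_derive t 1 (fun t : R => (u *m expmx (t *: M) *m x) 0 0)
    ((u *m M *m expmx (t *: M) *m x) 0 0).
Proof.
have ps v s := trajectory_pseries R d M x v s.
have E v : (fun t : R => (v *m expmx (t *: M) *m x) 0 0) =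
    (fun t => limn (pseries (trajectory_coef R d M x v) t)).
  by apply/funext => s; apply/esym/cvg_lim => //; exact: ps.
(* Termwise differentiation at [t] asks for convergence at a point of larger modulus; [|t| + 1] will
   do, as these series converge everywhere. *)
have lt : `|t| < `| `|t| + 1|.
  by rewrite [ltRHS]ger0_norm ?addr_ge0 // ltrDl.
have cv v s : cvgn (pseries (trajectory_coef R d M x v) s).
  by apply/cvg_ex; eexists; exact: ps.
have := @pseries_snd_diffs R (trajectory_coef R d M x u) (`|t| + 1) t.
rewrite !pseries_diffs_trajectory_coef => /(_ (cv _ _) (cv _ _) (cv _ _) lt).
by rewrite E -(congr1 (@^~ t) (E (u *m M))).
Qed.

Lemma trajectory_equilibrium (R : realType) (d : nat) (A : 'M[rat]_d)
    (x : 'cV[R]_d) (t : R) :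
  map_mx ratr A *m x = 0 -> trajectory A x t = x.
Proof.
move=> Ax; apply/colP => i; rewrite /trajectory.
have := trajectory_pseries R d (map_mx ratr A) x (delta_mx 0 i) t.
rewrite -mulmxA -rowE [X in _ --> X]mxE => /cvg_lim <- //.
(* The partial sums are constant only from index 1 on: the one at index 0 is empty. *)
apply: lim_near_cst => //; exists 1%N => // -[//|n] _.
rewrite /pseries /series /= big_nat_recl // big_nat_cond big1 ?addr0 => [|k _].
  by rewrite /trajectory_coef !expr0 mulmx1 fact0 divr1 mulr1 -rowE mxE.
by rewrite /trajectory_coef exprSr -!mulmxA [_ *m x]Ax !mulmx0 mxE !mul0r.
Qed.

(** * Compact polytopes *)

Lemma mulmx_row_continuous (R : realType) (d : nat) (u : 'rV[R]_d) :
  continuous (fun x : 'cV[R]_d => (u *m x) 0 0).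
Proof.
have := bilinear_mx_continuous R d 1 u 1%:M.
by under eq_fun do rewrite mulmx1.
Qed.

Lemma polytope_coord_argmax (R : realType) (n d : nat) (B : 'M[rat]_(n, d))
    (c : 'cV[rat]_n) (e : R) (j : 'I_d) :
  polytope R B c !=set0 -> compact (polytope R B c) ->
  exists2 z : 'cV[R]_d, polytope R B c z &
    forall x, polytope R B c x -> e * x j 0 <= e * z j 0.
Proof.
move=> P0 Pcompact.
have uE x : (e *: delta_mx 0 j *m x : 'M[R]_1) 0 0 = e * x j 0.
  by rewrite -scalemxAl -rowE !mxE.
have [|z /set_mem Pz zmax] := compact_EVT_max
    (f := fun x : 'cV[R]_d => (e *: delta_mx 0 j *m x : 'M[R]_1) 0 0)
    P0 Pcompact.
  exact/continuous_subspaceT/mulmx_row_continuous.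
by exists z => // x Px; rewrite -!uE zmax // inE.
Qed.

(** Otherwise the polytope would contain a line: translating a maximiser of coordinate [j] by [v]
    divided by [v j 0] would raise that coordinate by 1. *)
Lemma compact_polytope_kernel (R : realType) (n d : nat) (B : 'M[rat]_(n, d))
    (c : 'cV[rat]_n) (v : 'cV[R]_d) :
  polytope R B c !=set0 -> compact (polytope R B c) ->
  map_mx ratr B *m v = 0 -> v = 0.
Proof.
move=> P0 Pcompact Bv; apply/colP => j; rewrite [RHS]mxE; apply/eqP/negPn/negP => vj.
have [z Pz zmax] := polytope_coord_argmax _ _ _ _ _ 1 j P0 Pcompact.
have /zmax : polytope R B c (z + (v j 0)^-1 *: v).
  by move=> i; rewrite mulmxDr -scalemxAr Bv scaler0 addr0; exact: Pz.
by rewrite !mul1r mxE [X in _ + X]mxE mulVf // gerDl ler10.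
Qed.

Lemma polytope_coord_le (R : realType) (n d : nat) (B : 'M[rat]_(n, d))
    (c : 'cV[rat]_n) (x : 'cV[R]_d) (j : 'I_d) :
  compact (polytope R B c) -> polytope R B c x ->
  `|x j 0| <= (2 ^ (mx_bits B + mx_bits c))%:R.
Proof.
move=> Pcompact Px; have P0 : polytope R B c !=set0 by exists x.
have bound e : e != 0 -> e * x j 0 <= `|e| * (2 ^ (mx_bits B + mx_bits c))%:R.
  move=> e0; have [z Pz zmax] := polytope_coord_argmax _ _ _ _ _ e j P0 Pcompact.
  apply: le_trans (zmax _ Px) _; apply: le_trans (ler_norm _) _.
  rewrite normrM ler_wpM2l //.
  have [|leW _] := lp_optimum_bounds R n d B c e j z e0 _ Pz zmax.
    by move=> v; apply: compact_polytope_kernel P0 Pcompact.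
  apply: le_trans leW _; rewrite ler_nat; exact: system_weight_le_bits.
rewrite ler_norml lerNl; have := bound 1; have := bound (-1).
by rewrite !normrN1 !normr1 !mulN1r !mul1r oppr_eq0 oner_eq0 => -> // ->.
Qed.

(** * The least sup norm of [A x] over the polytope *)

Lemma sup_norm_lp_feasible (R : realType) (n d : nat) (A : 'M[rat]_d)
    (B : 'M[rat]_(n, d)) (c : 'cV[rat]_n) (x : 'cV[R]_d) (s : 'cV[R]_1) :
  (forall i, (map_mx ratr (sup_norm_lp_mx n d A B) *m col_mx x s) i 0 <=
     ratr (sup_norm_lp_rhs n d c i 0)) <->
  polytope R B c x /\ forall i, `|(map_mx ratr A *m x) i 0| <= s 0 0.
Proof.
have sE i : ((const_mx (-1) : 'M[R]_(d, 1)) *m s) i 0 = - s 0 0.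
  by rewrite mxE big_ord1 mxE mulN1r.
have rB i :
    (map_mx ratr (sup_norm_lp_mx n d A B) *m col_mx x s) (lshift _ i) 0 =
    (map_mx ratr B *m x) i 0.
  by rewrite map_col_mx mul_col_mx col_mxEu map_row_mx mul_row_col map_mx0 mul0mx addr0.
have rA i :
    (map_mx ratr (sup_norm_lp_mx n d A B) *m col_mx x s) (rshift _ (lshift _ i)) 0 =
    (map_mx ratr A *m x) i 0 - s 0 0.
  rewrite !map_col_mx !mul_col_mx col_mxEd col_mxEu map_row_mx mul_row_col.
  by rewrite map_const_mx rmorphN1 [LHS]mxE sE.
have rN i :
    (map_mx ratr (sup_norm_lp_mx n d A B) *m col_mx x s) (rshift _ (rshift _ i)) 0 =
    - (map_mx ratr A *m x) i 0 - s 0 0.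
  rewrite !map_col_mx !mul_col_mx !col_mxEd map_row_mx mul_row_col.
  by rewrite map_const_mx rmorphN1 [LHS]mxE sE map_mxN mulNmx [X in X - _]mxE.
have g0 i : ratr (sup_norm_lp_rhs n d c (rshift n i) 0) = 0 :> R.
  by rewrite col_mxEd mxE rmorph0.
split=> [feas|[Px Ax] i].
  split=> i; first by have := feas (lshift _ i); rewrite rB col_mxEu.
  rewrite ler_norml lerNl -![_ <= s 0 0]subr_le0 -rA -rN.
  have := feas (rshift n (lshift d i)); have := feas (rshift n (rshift d i)).
  by rewrite !g0 => -> ->.
case: (split_ordP i) => {}i ->; first by rewrite rB col_mxEu.
have := Ax; rewrite g0.
case: (split_ordP i) => {}i -> => /(_ i); rewrite ler_norml lerNl => /andP[Al Au].
  by rewrite rA subr_le0.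
by rewrite rN subr_le0.
Qed.

(** The block [B] kills the [x] part; any row of the [A] block, which exists because [d] is
    positive, then kills the unknown [s]. *)
Lemma sup_norm_lp_kernel (R : realType) (n d : nat) (A : 'M[rat]_d)
    (B : 'M[rat]_(n, d)) (v : 'cV[R]_(d + 1)) :
  (0 < d)%N -> (forall x : 'cV[R]_d, map_mx ratr B *m x = 0 -> x = 0) ->
  map_mx ratr (sup_norm_lp_mx n d A B) *m v = 0 -> v = 0.
Proof.
move=> d_gt0 kerB; rewrite -[v]vsubmxK !map_col_mx !mul_col_mx !map_row_mx !mul_row_col.
rewrite map_mx0 mul0mx addr0 => /eqP; rewrite !col_mx_eq0 => /andP[/eqP/kerB ->].
rewrite mulmx0 add0r => /andP[/eqP/colP/(_ (Ordinal d_gt0))].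
rewrite map_const_mx rmorphN1 mxE big_ord1 !mxE mulN1r => /eqP.
rewrite oppr_eq0 => /eqP s0 _.
suff -> : dsubmx v = 0 by rewrite col_mx0.
by apply/colP => i; rewrite ord1 !mxE.
Qed.

Definition sup_norm (R : realType) (d : nat) (y : 'cV[R]_d) : R :=
  \big[Num.max/0]_i `|y i 0|.

Lemma sup_norm_ge (R : realType) (d : nat) (y : 'cV[R]_d) i : `|y i 0| <= sup_norm R d y.
Proof. exact: le_bigmax. Qed.

Lemma sup_norm_mulmx_continuous (R : realType) (m d : nat) (A : 'M[R]_(m, d)) :
  continuous (fun x : 'cV[R]_d => sup_norm R m (A *m x)).
Proof.
move=> x; have FX : Filter (nbhs x) by exact: nbhs_filter.
apply: (cvg_big max_continuous FX) => i _; apply: cvg_norm.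
have rE z : (A *m z) i 0 = (row i A *m z) 0 0 by rewrite -row_mul [RHS]mxE.
rewrite rE; under eq_fun do rewrite rE.
exact: mulmx_row_continuous.
Qed.

(** If [a] minimises the sup norm of [A x], then [a] together with this minimum is optimal for
    minimising the last unknown [s] (hence [e = -1]). The minimum is nonzero because [a] is not an
    equilibrium, so the lower bound of [lp_optimum_bounds] applies. *)
Lemma sup_norm_lower_bound (R : realType) (n d : nat) (A : 'M[rat]_d)
    (B : 'M[rat]_(n, d)) (c : 'cV[rat]_n) (x : 'cV[R]_d) :
  compact (polytope R B c) ->
  (forall a : 'cV[R]_d, polytope R B c a -> map_mx ratr A *m a != 0) ->
  polytope R B c x ->
  1 <= (2 ^ (mx_bits B + mx_bits c + 2 * (mx_bits A + d)))%:R *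
       sup_norm R d (map_mx ratr A *m x).
Proof.
move=> Pcompact noeq Px; have P0 : polytope R B c !=set0 by exists x.
pose N (z : 'cV[R]_d) := sup_norm R d (map_mx ratr A *m z).
have [|a /set_mem Pa Nmin] := compact_EVT_min (f := N) P0 Pcompact.
  exact/continuous_subspaceT/sup_norm_mulmx_continuous.
have [i Aai] : exists i, (map_mx ratr A *m a) i 0 != 0.
  apply/existsP; apply: contraNT (noeq _ Pa) => /existsPn Aa0.
  by apply/eqP/colP => i; rewrite [RHS]mxE; apply/eqP/negPn/Aa0.
have d_gt0 : (0 < d)%N := leq_ltn_trans (leq0n i) (ltn_ord i).
have Na_gt0 : 0 < N a.
  by apply: lt_le_trans (sup_norm_ge _ _ _ i); rewrite normr_gt0.
have lastE (z : 'cV[R]_d) (s : 'cV[R]_1) : 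
    col_mx z s (rshift d 0) 0 = s 0 0 by rewrite col_mxEd.
have [|||z|_ geW] := lp_optimum_bounds R _ _ (sup_norm_lp_mx n d A B)
    (sup_norm_lp_rhs n d c) (-1) (rshift d 0) (col_mx a (const_mx (N a))).
- by rewrite oppr_eq0 oner_eq0.
- move=> v; apply: sup_norm_lp_kernel => // w.
  exact: compact_polytope_kernel P0 Pcompact.
- by apply/sup_norm_lp_feasible; split=> // k; rewrite [leRHS]mxE sup_norm_ge.
- rewrite -[z]vsubmxK => /sup_norm_lp_feasible[Pz Az].
  rewrite !lastE [const_mx _ _ _]mxE !mulN1r lerN2; apply: le_trans (Nmin _ (mem_set Pz)) _.
  by apply: bigmax_le => [|k _]; [apply: le_trans (Az i) | exact: Az].
have := geW; rewrite lastE mxE gt_eqF // => /(_ isT); rewrite gtr0_norm // => le1.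
apply: le_trans le1 _; apply: ler_pM => //; first exact: ltW.
  by rewrite ler_nat sup_norm_lp_weight_le_bits.
exact/Nmin/mem_set.
Qed.

(** * Separation of the image from the origin, and norm estimates *)

Lemma dot_mulmx_continuous (R : realType) (m d : nat) (A : 'M[R]_(m, d)) :
  continuous (fun x : 'cV[R]_d => ((A *m x)^T *m (A *m x)) 0 0).
Proof.
have -> : (fun x : 'cV[R]_d => ((A *m x)^T *m (A *m x)) 0 0) =
    (fun x => \sum_i (row i A *m x) 0 0 * (row i A *m x) 0 0).
  apply/funext => x; rewrite mxE; apply: eq_bigr => i _; rewrite [_^T 0 i]mxE.
  by rewrite -row_mul [in RHS]mxE.
move=> x; have FX : Filter (nbhs x) by exact: nbhs_filter.
apply: (cvg_big add_continuous FX) => i _.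
by apply: cvgM; apply: mulmx_row_continuous.
Qed.

Lemma polytope_convex (R : realType) (n d : nat) (B : 'M[rat]_(n, d))
    (c : 'cV[rat]_n) (a x : 'cV[R]_d) (r : R) :
  0 <= r <= 1 -> polytope R B c a -> polytope R B c x ->
  polytope R B c (a + r *: (x - a)).
Proof.
move=> /andP[r0 r1] Pa Px i; have := Pa i; have := Px i.
rewrite mulmxDr -scalemxAr mulmxBr.
rewrite [X in _ -> _ -> X <= _]mxE [X in _ -> _ -> _ + X <= _]mxE.
rewrite [X in _ -> _ -> _ + _ * X <= _]mxE [X in _ -> _ -> _ + _ * (_ + X) <= _]mxE.
set p := (_ *m x) i 0; set q := (_ *m a) i 0; set g := ratr _ => pg qg.
nra.
Qed.

(** The point [A a] is the point of the image closest to the origin. Moving from [a] towards [x] by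
    a fraction [r] changes the squared norm by [2 * r * p + r ^+ 2 * q], which would be negative for
    a suitable [r] if [p] were negative. *)
Lemma min_norm_separation (R : realType) (n d : nat) (A : 'M[R]_d)
    (B : 'M[rat]_(n, d)) (c : 'cV[rat]_n) :
  polytope R B c !=set0 -> compact (polytope R B c) ->
  exists2 a, polytope R B c a & forall x, polytope R B c x ->
    ((A *m a)^T *m (A *m a)) 0 0 <= ((A *m a)^T *m (A *m x)) 0 0.
Proof.
move=> P0 Pcompact.
have [|a /set_mem Pa amin] := compact_EVT_min
    (f := fun x : 'cV[R]_d => ((A *m x)^T *m (A *m x)) 0 0) P0 Pcompact.
  exact/continuous_subspaceT/dot_mulmx_continuous.
exists a => // x Px; set y := A *m a; pose w := A *m x - y.
have dotC : (w^T *m y) 0 0 = (y^T *m w) 0 0.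
  by rewrite -[w^T *m y]trmxK [LHS]mxE trmx_mul trmxK.
suff : 0 <= (y^T *m w) 0 0 by rewrite mulmxBr mxE [X in _ + X]mxE subr_ge0.
rewrite leNgt; apply/negP => yw_lt0.
set p := (y^T *m w) 0 0 in dotC yw_lt0 *; set q := (w^T *m w) 0 0.
have q_ge0 : 0 <= q.
  by rewrite /q mxE sumr_ge0 // => i _; rewrite mxE -expr2 sqr_ge0.
have step r : 0 <= r <= 1 -> 0 <= 2 * r * p + r ^+ 2 * q.
  move=> r01; have := amin _ (mem_set (polytope_convex _ _ _ _ _ _ _ _ r01 Pa Px)).
  have -> : A *m (a + r *: (x - a)) = y + r *: w by rewrite mulmxDr -scalemxAr mulmxBr.
  have -> : (y + r *: w)^T = y^T + r *: w^T by apply/matrixP => i j; rewrite !mxE.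
  rewrite mulmxDl !mulmxDr -!scalemxAl -!scalemxAr.
  rewrite -/y [X in _ <= X -> _]mxE [X in _ <= X + _ -> _]mxE [X in _ <= _ + X -> _]mxE.
  rewrite [X in _ <= _ + X + _ -> _]mxE [X in _ <= _ + (X + _) -> _]mxE.
  rewrite [X in _ <= _ + (_ + X) -> _]mxE [X in _ <= _ + (_ + _ * X) -> _]mxE.
  rewrite dotC -/p -/q; lra.
have pq_gt0 : 0 < q - p by lra.
(* The denominator [q - p] is positive even when [q = 0], and it keeps [r] at most 1. Here
   [2 * p + r * q = (1 + r) * p < 0]. *)
have := step (- p / (q - p)).
have -> : 0 <= - p / (q - p) <= 1.
  rewrite divr_ge0 ?oppr_ge0 ?(ltW yw_lt0) ?(ltW pq_gt0) //=.
  by rewrite ler_pdivrMr // mul1r lerDr.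
move=> /(_ isT).
set r := - p / (q - p); have rq : r * (q - p) = - p by rewrite divfK ?gt_eqF.
have r_gt0 : 0 < r by rewrite divr_gt0 // oppr_gt0.
nra.
Qed.

Lemma sup_norm_attained (R : realType) (d : nat) (y : 'cV[R]_d) :
  (0 < d)%N -> exists i, sup_norm R d y = `|y i 0|.
Proof.
move=> d_gt0; rewrite /sup_norm (bigmax_eq_arg _ (Ordinal d_gt0)) //.
by eexists.
Qed.

Lemma sup_norm_sqr_le (R : realType) (d : nat) (y : 'cV[R]_d) :
  sup_norm R d y ^+ 2 <= (y^T *m y) 0 0.
Proof.
have dotE : (y^T *m y) 0 0 = \sum_i y i 0 ^+ 2.
  by rewrite mxE; apply: eq_bigr => i _; rewrite mxE expr2.
case: d y dotE => [|d] y ->; first by rewrite /sup_norm !big_ord0 expr0n.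
have [i ->] := sup_norm_attained R d.+1 y isT.
rewrite real_normK ?num_real // (bigD1 i) //= lerDl sumr_ge0 // => k _.
exact: sqr_ge0.
Qed.

Lemma dot_le_sup_norm (R : realType) (d : nat) (y x x' : 'cV[R]_d) (X : R) :
  (forall i, `|x i 0| <= X) -> (forall i, `|x' i 0| <= X) ->
  (y^T *m x) 0 0 - (y^T *m x') 0 0 <= d%:R * (sup_norm R d y * (2 * X)).
Proof.
move=> xX xX'; rewrite !mxE -sumrB.
rewrite mulr_natl -[X in _ *+ X]card_ord -sumr_const; apply: ler_sum => i _.
rewrite !mxE -mulrBr; apply: le_trans (ler_norm _) _; rewrite normrM.
apply: ler_pM => //; first exact: sup_norm_ge.
rewrite mulr_natl mulr2n; apply: le_trans (ler_normB _ _) _.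
by rewrite lerD.
Qed.

(** * Escape time *)

(** Without escape before [T], the growth of [y . x(t)] and the bound on coordinates give
    [T <= d * 2 * X * W], with [X] bounding the coordinates and [1 / W] bounding the sup norm of
    [A x] from below. The final [+ 1] in [T] makes this absurd. *)
Lemma escape_time_bound (R : realType) (n d : nat) (A : 'M[rat]_d)
    (B : 'M[rat]_(n, d)) (c : 'cV[rat]_n) (x0 : 'cV[R]_d)
    (T : R := d%:R * 2 * (2 ^ (mx_bits B + mx_bits c))%:R *
       (2 ^ (mx_bits B + mx_bits c + 2 * (mx_bits A + d)))%:R + 1) :
  cpep_positive R A B c -> compact (polytope R B c) -> polytope R B c x0 ->
  exists t0 : R, 0 <= t0 <= T /\ ~ polytope R B c (trajectory A x0 t0).
Proof.
move=> pos Pcompact Px0; have P0 : polytope R B c !=set0 by exists x0.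
have T_gt0 : 0 < T by rewrite ltr_wpDl // !mulr_ge0.
have noeq (a : 'cV[R]_d) : polytope R B c a -> map_mx ratr A *m a != 0.
  move=> Pa; apply/eqP => Aa; have [t _] := pos a Pa.
  by rewrite trajectory_equilibrium.
apply: contrapT => noescape.
have inP t : 0 <= t <= T -> polytope R B c (trajectory A x0 t).
  by move=> tT; apply: contrapT => nP; apply: noescape; exists t.
have [a Pa sep] := min_norm_separation R n d (map_mx ratr A) B c P0 Pcompact.
set y := map_mx ratr A *m a in sep.
pose f t := (y^T *m expmx (t *: map_mx ratr A) *m x0) 0 0.
have fE t : f t = (y^T *m trajectory A x0 t) 0 0 by rewrite /f -mulmxA.
have f_derive t := is_derive_trajectory R d (map_mx ratr A) x0 y^T t.
have f_cont : {within `[0, T], continuous f}.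
  by apply: derivable_within_continuous => t _; have [] := f_derive t.
have [t t_in fTE] := MVT_segment (ltW T_gt0) (fun t _ => f_derive t) f_cont.
have t_01 : 0 <= t <= T by move: t_in; rewrite in_itv.
have D_le : (y^T *m y) 0 0 * T <= f T - f 0.
  (* By the mean value theorem the increment is [T] times [y . A x(t)] at some [t], where the
     trajectory still lies in the polytope, so [sep] applies. *)
  rewrite fTE subr0 ler_pM2r // -!mulmxA; apply: sep; exact: inP.
have f_le : f T - f 0 <= d%:R * (sup_norm R d y * (2 * (2 ^ (mx_bits B + mx_bits c))%:R)).
  rewrite !fE; apply: dot_le_sup_norm => i; apply: polytope_coord_le => //; apply: inP.
    by rewrite lexx ltW.
  by rewrite lexx ltW.
have D_ge := sup_norm_sqr_le R d y.
have W_ge := sup_norm_lower_bound R n d A B c a Pcompact noeq Pa.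
rewrite -/y in W_ge.
move: D_le f_le D_ge W_ge.
set mu := sup_norm R d y; set X := (2 ^ (_ + mx_bits c))%:R.
set W := (2 ^ (_ + 2 * _))%:R; set D := (_ *m _) 0 0 => D_le f_le D_ge W_ge.
have TE : T = d%:R * 2 * X * W + 1 := erefl.
have W_ge0 : 0 <= W := ler0n _ _.
clearbody X W D mu.
have mu_gt0 : 0 < mu.
  rewrite ltNge; apply/negP => mu_le0.
  have := le_trans W_ge (mulr_ge0_le0 W_ge0 mu_le0); by rewrite ler10.
(* One factor [mu] cancels between [mu ^+ 2 <= D] and the bound on the increment, which is linear in
   [mu]. *)
have muT : mu * T <= d%:R * 2 * X.
  rewrite -(ler_pM2l mu_gt0) mulrA -expr2.
  apply: le_trans (_ : _ <= D * T) _; first by rewrite ler_pM2r.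
  apply: le_trans D_le (le_trans f_le _).
  by rewrite le_eqVlt; apply/orP; left; apply/eqP; ring.
have : T <= d%:R * 2 * X * W.
  apply: le_trans (_ : T <= W * mu * T) _; first by rewrite ler_peMl // ltW.
  by rewrite [leRHS]mulrC -mulrA ler_wpM2l.
by rewrite TE gerDl ler10.
Qed.

Lemma mx_bits_ge (m n : nat) (M : 'M[rat]_(m, n)) : (m * n <= mx_bits M)%N.
Proof.
rewrite /mx_bits -[leqLHS](_ : (\sum_(i < m) \sum_(j < n) 1)%N = _).
  by apply: leq_sum => i _; apply: leq_sum.
by under eq_bigr do rewrite sum1_card card_ord; rewrite sum_nat_const card_ord.
Qed.

Theorem mainTheorem3 (R : realType) :
  exists C : R, forall (n d : nat)
    (A : 'M[rat]_d) (B : 'M[rat]_(n, d)) (c : 'cV[rat]_n) (b : nat),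
    cpep_bits A B c = b ->
    cpep_positive R A B c ->
    compact (polytope R B c) ->
    diagonalizable_over_C R A \/ A \in unitmx ->
    exists T : R, T <= C * 4 ^+ (b * d ^ 2) /\
      forall x0 : 'cV[R]_d, polytope R B c x0 ->
        exists t0 : R, 0 <= t0 <= T /\
          ~ polytope R B c (trajectory A x0 t0).
Proof.
(* The final comparison of exponents is [1 + 3 * d + 2 * b <= 5 + 2 * b * d ^ 2], whence
   [32 = 2 ^ 5]; for [d >= 2] it uses [d * d <= b], each entry of [A] taking at least one bit. *)
exists 32 => n d A B c b bE pos Pcompact _.
eexists; split; last by move=> x0; exact: escape_time_bound pos Pcompact.
rewrite -!natrM natr1 -natrX -natrM ler_nat.
have leAb : (d * d <= b)%N.
  by rewrite -bE /cpep_bits -addnA; apply: leq_trans (mx_bits_ge _ _ A) (leq_addr _ _).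
rewrite -mulnA -expnD.
have -> : (mx_bits B + mx_bits c + (mx_bits B + mx_bits c + 2 * (mx_bits A + d)) =
  2 * b + 2 * d)%N by rewrite -bE /cpep_bits; lia.
(* In dimension 0 the time bound reduces to 1. *)
have [->|d_gt0] := posnP d; first by rewrite !mul0n muln_gt0 expn_gt0.
have le_d : (d.+1 <= 2 ^ d)%N by apply: ltn_expl.
(* With [q = 2 ^ (2 * b + 2 * d)], the added 1 is absorbed by [2 * d * q + 1 <= 2 * d.+1 * q], and
   [d.+1 <= 2 ^ d]. *)
apply: (@leq_trans (2 ^ (1 + d + (2 * b + 2 * d)))).
  rewrite (expnD _ (1 + d)) (expnD _ 1) expn1.
  have : (0 < 2 ^ (2 * b + 2 * d))%N by rewrite expn_gt0.
  move: (2 ^ (2 * b + 2 * d))%N (2 ^ d)%N le_d => q p; nia.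
rewrite (_ : 4 = 2 ^ 2)%N // -expnM (_ : 32 = 2 ^ 5)%N // -expnD.
rewrite leq_exp2l //; nia.
Qed.
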